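(* For every period $n\in\mathbb{N}$, $n\geq 1$, there exist $n$ linearly independent, mutually orthogonal $n$-periodic sequences $\mathbf{u}(\tfrac1n,j)$, $j\in\{1,\dots,n\}$, in $\mathbb{C}[\mathcal{G}]$ whose principal subsequences over $\mathbb{Z}/n\mathbb{Z}$, i.e. the tuples of values at the sites $1,\dots,n$, form an orthogonal basis and satisfy $$\mathbf{u}\bigl(\tfrac1n,j\bigr)=(0,\dots,0,n,0,\dots,0)=n\,\mathbf{e}_j,$$ where the non-zero value $n$ is at the $j$-th coordinate and $\mathbf{e}_j$ is the $j$-th standard basis vector of $\mathbb{C}^n$.
   Context: $\mathcal{G}$ is the group (under pointwise multiplication) of all sequences $u:\mathbb{Z}\to\mathbb{C}$ of the form $u[m]=\exp(2\pi i(\alpha m+\beta))$ with $\alpha,\beta\in\mathbb{Q}$. $\mathbb{C}[\mathcal{G}]$ denotes the algebra of sequences $\mathbb{Z}\to\mathbb{C}$ that are finite $\mathbb{C}$-linear combinations of elements of $\mathcal{G}$, with pointwise addition and pointwise multiplication. Orthogonality is with respect to the standard Hermitian inner product on $\mathbb{C}^n$ applied to principal subsequences. *)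

(* Defs.v *)
From HB Require Import structures.
From mathcomp Require Import all_boot all_order all_algebra.
From mathcomp Require Import spectral complex.
From mathcomp Require Import all_classical all_reals all_analysis.

Set Implicit Arguments.
Unset Strict Implicit.
Unset Printing Implicit Defensive.

Import Order.TTheory GRing.Theory Num.Theory.

Local Open Scope classical_set_scope.
Local Open Scope complex_scope.
Local Open Scope ring_scope.

(* e^(x + i y) = e^x (cos y + i sin y); the libraries have no exponential
   on R[i]. *)
Definition cexp (R : realType) (z : R[i]) : R[i] :=
  (expR (complex.Re z))%:C * (cos (complex.Im z) +i* sin (complex.Im z)).

Definition calG (R : realType) : set (int -> R[i]) :=
  [set u | exists alpha beta : rat, forall m : int,
     u m = cexp ((2 * pi * (ratr alpha * m%:~R + ratr beta)) *i)].

Definition algCG (R : realType) : set (int -> R[i]) :=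
  [set u | exists (k : nat) (c : 'I_k -> R[i]) (g : 'I_k -> int -> R[i]),
     (forall i, calG (g i)) /\
     forall m : int, u m = \sum_(i < k) c i * g i m].

Definition lin_indep_seqs (R : realType) (k : nat)
    (u : 'I_k -> int -> R[i]) : Prop :=
  forall c : 'I_k -> R[i],
    (forall m : int, \sum_(j < k) c j * u j m = 0) -> forall j, c j = 0.

(* Coordinate k : 'I_n, counted from 0, is the value at the site k + 1, so that
   the row lists the values at the sites 1, ..., n. *)
Definition principal (R : realType) (n : nat) (u : int -> R[i]) :
    'rV[R[i]]_n :=
  \row_(k < n) u (k.+1)%:Z.

Definition orthogonal_seqs (R : realType) (n : nat)
    (u v : int -> R[i]) : Prop :=
  dotmx (principal n u) (principal n v) = 0.

Definition orthogonal_basis (R : realType) (n : nat)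
    (s : seq 'rV[R[i]]_n) : Prop :=
  basis_of fullv s /\ pairwise_orthogonal (@dotmx _ n) s.

(* Main.v *)
Require Import Defs.
From HB Require Import structures.
From mathcomp Require Import all_boot all_order all_algebra.
From mathcomp Require Import spectral complex.
From mathcomp Require Import all_classical all_reals all_analysis.

Import Order.TTheory GRing.Theory Num.Theory.

Local Open Scope complex_scope.
Local Open Scope ring_scope.

(** The sequence u(1/n, j) is the Dirichlet kernel of the group of n-th roots
    of unity, shifted so that its peak lies at the site j: its value at m is
    the sum over t < n of exp (2 i pi t (m - j) / n). Each summand is, as a
    function of m, an element of calG with alpha = t / n and
    beta = - t j / n, so the sequence belongs to the algebra of calG by
    construction. The summands are also the powers z ^ t of the single n-th
    root of unity z = exp (2 i pi (m - j) / n). If n divides m - j then z = 1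
    and the sum is n; otherwise z <> 1, and (z - 1) times the sum is
    z ^ n - 1 = 0, so the sum vanishes ([sum_root_of_unity]). Hence u(1/n, j)
    is n times the indicator of the residue class of j, which gives
    periodicity and the values n e_j on the sites 1, ..., n; orthogonality and
    independence are those of the standard basis.

    The only analytic input is that exp (2 i pi x) takes the value 1 at the
    integers and nowhere else, which comes from the positivity of sin on the
    open interval from 0 to pi ([cis_neq1]). *)

(** The character x |-> exp (2 i pi x) of the real line, with its period
    normalised to 1. *)
Definition cis {R : realType} (x : R) : R[i] := cexp ((2 * pi * x) *i).

Lemma cisE (R : realType) (x : R) :
  cis x = cos (2 * pi * x) +i* sin (2 * pi * x).
Proof. by rewrite /cis /cexp /= expR0 mul1r. Qed.

Lemma cisD (R : realType) (x y : R) : cis (x + y) = cis x * cis y.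
Proof.
rewrite !cisE mulrDr cosD sinD; simpc.
by congr (_ +i* _); rewrite addrC [cos _ * _]mulrC.
Qed.

Lemma cis0 (R : realType) : cis 0 = 1 :> R[i].
Proof. by rewrite cisE mulr0 cos0 sin0. Qed.

Lemma cisMn (R : realType) (x : R) (k : nat) : cis (x *+ k) = cis x ^+ k.
Proof. by elim: k => [|k IHk]; rewrite ?mulr0n ?cis0 // mulrS cisD IHk exprS. Qed.

Lemma cis1 (R : realType) : cis 1 = 1 :> R[i].
Proof. by rewrite cisE mulr1 mulr_natl cos2pi sin2pi. Qed.

Lemma cis_int (R : realType) (m : int) : cis m%:~R = 1 :> R[i].
Proof.
have cis_nat (k : nat) : cis k%:R = 1 :> R[i] by rewrite cisMn cis1 expr1n.
case: m => k; first exact: cis_nat.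
rewrite NegzE mulrNz; have := cisD R (- k.+1%:R) k.+1%:R.
by rewrite addNr cis0 cis_nat mulr1 => <-.
Qed.

(** By the duplication formula, cos (2 pi x) = 1 - 2 sin (pi x) ^ 2, and
    sin (pi x) > 0, so the real part of cis x is below 1. *)
Lemma cis_neq1 (R : realType) (x : R) : 0 < x < 1 -> cis x != 1.
Proof.
move=> /andP[x0 x1]; have sin_gt0 : 0 < sin (pi * x).
  by apply: sin_gt0_pi; rewrite mulr_gt0 ?pi_gt0 //= gtr_pMr ?pi_gt0.
rewrite cisE eq_complex /= negb_and; apply/orP; left.
rewrite -mulrA mulr_natl cos_mulr2n cos2sin2 mulrnBl.
by rewrite addrAC [1 *+ 2]mulr2n addrK lt_eqF // gtrBl pmulrn_lgt0 // exprn_gt0.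
Qed.

(** The quotient of m by n contributes an integer to the argument, hence a
    factor 1; the remainder contributes a fraction in [0, 1), where
    [cis_neq1] leaves only 0. *)
Lemma cis_frac_eq1 (R : realType) (n : nat) (m : int) : (0 < n)%N ->
  (cis (m%:~R / n%:R : R) == 1) = (n %| m)%Z.
Proof.
move=> n0; have nR : (n%:R : R) != 0 by rewrite pnatr_eq0 -lt0n.
have nZ : n%:Z != 0 by rewrite -lt0n.
rewrite {1}(divz_eq m n%:Z) intrD intrM mulrDl mulfK // cisD cis_int mul1r.
rewrite (sameP dvdz_mod0P eqP).
have [->|r_neq0] := eqVneq (m %% n%:Z)%Z 0; first by rewrite mul0r cis0 eqxx.
have r_gt0 : 0 < (m %% n%:Z)%Z by rewrite lt_def r_neq0 modz_ge0.
apply/negbTE/cis_neq1; rewrite divr_gt0 ?ltr0z ?ltr0n //=.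
by rewrite ltr_pdivrMr ?ltr0n // mul1r pmulrn ltr_int ltz_pmod.
Qed.

(** Orthogonality of characters of the cyclic group of order n, as a geometric
    sum. *)
Lemma sum_root_of_unity (R : realType) (n : nat) (m : int) : (0 < n)%N ->
  \sum_(t < n) cis (t%:R * (m%:~R / n%:R) : R) = n%:R *+ (n %| m)%Z.
Proof.
move=> n0; set x : R := m%:~R / n%:R.
have nR : (n%:R : R) != 0 by rewrite pnatr_eq0 -lt0n.
under eq_bigr do rewrite mulr_natl cisMn.
rewrite -(cis_frac_eq1 R n m n0) -/x.
have [->|x_neq1] := eqVneq (cis x) 1.
  by under eq_bigr do rewrite expr1n; rewrite sumr_const card_ord.
apply: (@mulfI _ (cis x - 1)); first by rewrite subr_eq0.
rewrite -subrX1 -cisMn -[x *+ n]mulr_natr /x divfK //.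
by rewrite cis_int subrr mulr0.
Qed.

(** The n-th Dirichlet kernel, shifted by [a]: the Fourier expansion of n times the
    indicator of the residue class of [a] modulo n. *)
Definition kernel_at (R : realType) (n : nat) (a : int) (m : int) : R[i] :=
  \sum_(t < n) cis (t%:R * ((m - a)%:~R / n%:R) : R).

Lemma kernel_atE (R : realType) (n : nat) (a m : int) : (0 < n)%N ->
  kernel_at R n a m = n%:R *+ (n %| m - a)%Z.
Proof. exact: sum_root_of_unity. Qed.

(** The shift by [a] is absorbed in the phase beta of each summand, and the
    phases t a / n stay rational because [a] is an integer. *)
Lemma kernel_at_algCG (R : realType) (n : nat) (a : int) :
  algCG (kernel_at R n a).
Proof.
exists n, (fun=> 1), (fun t m => cis (t%:R * ((m - a)%:~R / n%:R))).
split=> [t|m]; last by apply: eq_bigr => t _; rewrite mul1r.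
exists (t%:R / n%:R), (- (t%:R * a%:~R / n%:R)) => m.
rewrite -[RHS]/(cis _); congr (cis _).
rewrite rmorphN !rmorphM /= !fmorphV !rmorph_nat rmorph_int intrB.
by rewrite mulrBl mulrBr !mulrA [_ / _ * _]mulrAC.
Qed.

Lemma kernel_at_periodic (R : realType) (n : nat) (a : int) : (0 < n)%N ->
  periodic (kernel_at R n a) n%:Z.
Proof.
by move=> n0 m; rewrite !kernel_atE // addrAC rpredDr ?dvdzz.
Qed.

(** Distinct sites among 1, ..., n are not congruent modulo n, so exactly one
    of them meets the residue class on which the kernel is non-zero. *)
Lemma principal_kernel_at (R : realType) (n : nat) (j : 'I_n) :
  principal n (kernel_at R n j.+1%:Z) = n%:R *: delta_mx 0 j.
Proof.
have n0 : (0 < n)%N := leq_ltn_trans (leq0n j) (ltn_ord j).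
apply/rowP=> k; rewrite !mxE kernel_atE // eqxx /= mulr_natr.
congr (_ *+ nat_of_bool _).
rewrite -eqz_mod_dvd -[k.+1]addn1 -[j.+1]addn1 !PoszD eqz_modDr.
by rewrite !modz_small ?ltz_nat ?ltn_ord.
Qed.

Lemma dotmx_delta (C : numClosedFieldType) (n : nat) (j k : 'I_n) (a : C) :
  j != k -> dotmx (a *: delta_mx 0 j) (a *: delta_mx 0 k : 'rV[C]_n) = 0.
Proof.
move=> jk; rewrite dotmxE mxE big1 // => i _; rewrite !mxE /=.
have [->|_] := eqVneq i j; last by rewrite mulr0 mul0r.
by rewrite (negbTE jk) mulr0 rmorph0 mulr0.
Qed.

Lemma delta_orthogonal_basis (R : realType) (n : nat) (a : R[i]) : a != 0 ->
  orthogonal_basis [seq a *: delta_mx 0 j : 'rV[R[i]]_n | j <- enum 'I_n].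
Proof.
move=> a0; set s := map _ _.
have v0 (j : 'I_n) : a *: delta_mx 0 j != 0 :> 'rV[R[i]]_n.
  rewrite scaler_eq0 negb_or a0; apply/eqP => /rowP/(_ j).
  by rewrite !mxE !eqxx => /eqP; rewrite oner_eq0.
have v_inj : injective (fun j => a *: delta_mx 0 j : 'rV[R[i]]_n).
  move=> j k /rowP/(_ j); rewrite !mxE !eqxx /= mulr1 => /eqP.
  by have [//|_] := eqVneq j k; rewrite mulr0 (negbTE a0).
have s_orth : pairwise_orthogonal (@dotmx _ n) s.
  apply/pairwise_orthogonalP; split.
    rewrite /= map_inj_uniq ?enum_uniq // andbT.
    by apply/mapP => -[j _ /esym/eqP]; rewrite (negbTE (v0 j)).
  move=> _ _ /mapP[j _ ->] /mapP[k _ ->] jk; apply: dotmx_delta.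
  by apply: contraNneq jk => ->.
split=> //; rewrite basisEfree (orthogonal_free s_orth) subvf /=.
by rewrite dimvf /dim /= mul1n size_map size_enum_ord.
Qed.

(* The index j : 'I_n counts from 0: u j is the sequence u(1/n, j + 1). *)
Theorem theorem7p7 (R : realType) (n : nat) (hn : (1 <= n)%N) :
  exists u : 'I_n -> int -> R[i],
    (forall j : 'I_n, algCG (u j)) /\
    (forall j : 'I_n, periodic (u j) n%:Z) /\
    lin_indep_seqs u /\
    (forall j k : 'I_n, j != k -> orthogonal_seqs n (u j) (u k)) /\
    orthogonal_basis [seq principal n (u j) | j <- enum 'I_n] /\
    (forall j : 'I_n, principal n (u j) = n%:R *: delta_mx 0 j).
Proof.
have n_neq0 : n%:R != 0 :> R[i] by rewrite pnatr_eq0 -lt0n.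
exists (fun j => kernel_at R n j.+1%:Z).
split; [|split; [|split; [|split; [|split]]]].
- by move=> j; apply: kernel_at_algCG.
- by move=> j; apply: kernel_at_periodic.
- move=> c c_sum j.
  (* At the site j + 1 only the j-th sequence is non-zero. *)
  have := c_sum j.+1%:Z; rewrite (bigD1 j) //= big1 => [|k kj].
    have /rowP/(_ j) := principal_kernel_at R n j.
    rewrite !mxE !eqxx mulr1 addr0 => -> /eqP.
    by rewrite mulf_eq0 (negbTE n_neq0) orbF => /eqP.
  have /rowP/(_ j) := principal_kernel_at R n k.
  by rewrite !mxE eq_sym (negbTE kj) !mulr0 => ->; rewrite mulr0.
- by move=> j k jk; rewrite /orthogonal_seqs !principal_kernel_at dotmx_delta.
- under eq_map do rewrite principal_kernel_at.
  exact: delta_orthogonal_basis.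
- exact: principal_kernel_at.
Qed.
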